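(* Let $x_1,x_2,y_1,y_2,v_1,v_2,p_1,p_2,q_1,q_2,r$ be indeterminates, and for $n\ge0$ define $$\begin{aligned}B_n(x_1,x_2,y_1,y_2,v_1,v_2,p_1,p_2,q_1,q_2,r)=\sum_{\pi\in\Pi_n}\;&x_1^{m_1(\pi)}x_2^{m_{\ge2}(\pi)}y_1^{\mathrm{erecin}(\pi)}y_2^{\mathrm{erecop}(\pi)}v_1^{\mathrm{nerecin}(\pi)}v_2^{\mathrm{nerecop}(\pi)}\\&\times p_1^{\mathrm{crin}(\pi)}p_2^{\mathrm{crop}(\pi)}q_1^{\mathrm{nein}(\pi)}q_2^{\mathrm{neop}(\pi)}r^{\mathrm{psne}(\pi)}.\end{aligned}$$ Then $$\sum_{n=0}^\infty B_n(x_1,x_2,y_1,y_2,v_1,v_2,p_1,p_2,q_1,q_2,r)\,t^n=\cfrac{1}{1-\gamma_0 t-\cfrac{\beta_1t^2}{1-\gamma_1t-\cfrac{\beta_2t^2}{1-\gamma_2 t-\cdots}}}$$ with coefficients $\gamma_0=x_1$ and, for $n\ge1$, $$\gamma_n=r^nx_1+p_1^{n-1}y_1+q_1[n-1]_{p_1,q_1}v_1,\qquad \beta_n=x_2\bigl(p_2^{n-1}y_2+q_2[n-1]_{p_2,q_2}v_2\bigr).$$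
   Context: $[n]_{p,q}=\sum_{j=0}^{n-1}p^jq^{n-1-j}$ (so $[0]_{p,q}=0$). $\Pi_n$ is the set of partitions of $[n]=\{1,\dots,n\}$ into nonempty blocks. Continued fractions are identities of formal power series in $t$. For $\pi\in\Pi_n$, an element $i\in[n]$ is an opener if it is the smallest element of a block of size $\ge2$; a closer if it is the largest element of a block of size $\ge2$; an insider if it is a non-opener non-closer element of a block of size $\ge3$; a singleton if it is the sole element of a block of size 1. For $i\in[n]$ let $\sigma'(i)$ be the next-larger element after $i$ in its block if $i$ is not the largest element of its block, and $\sigma'(i)=0$ otherwise; $i$ is an exclusive record of $\pi$ if $\sigma'(i)\ne0$ and $\sigma'(j)<\sigma'(i)$ for all $j<i$ (an exclusive record is always an opener or an insider). $m_1(\pi)$ is the number of singletons, $m_{\ge2}(\pi)$ the number of blocks of size $\ge2$, $\mathrm{erecin}(\pi)$ [resp. $\mathrm{erecop}(\pi)$] the number of insiders [resp. openers] that are exclusive records, and $\mathrm{nerecin}(\pi)$ [resp. $\mathrm{nerecop}(\pi)$] the number of insiders [resp. openers] that are not exclusive records. $\mathcal G_\pi$ is the graph on vertex set $[n]$ whose edges join consecutive elements within the same block; edges are written $(i,j)$ with $i<j$. A quadruplet $i<j<k<l$ is a crossing if $(i,k),(j,l)\in\mathcal G_\pi$, and a nesting if $(i,l),(j,k)\in\mathcal G_\pi$. $\mathrm{crop}(\pi)$ [resp. $\mathrm{crin}(\pi)$] is the number of crossings $i<j<k<l$ in which $j$ is an opener [resp. insider]; $\mathrm{neop}(\pi)$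 [resp. $\mathrm{nein}(\pi)$] is the number of nestings $i<j<k<l$ in which $j$ is an opener [resp. insider]. $\mathrm{psne}(\pi)$ is the number of triplets $i<j<l$ such that $j$ is a singleton and $(i,l)\in\mathcal G_\pi$. *)

(* Defs.v *)
From mathcomp Require Import all_boot all_order all_algebra.
Set Implicit Arguments.
Unset Strict Implicit.
Unset Printing Implicit Defensive.
Import GRing.Theory.
Local Open Scope ring_scope.

Definition pqnum (R : comNzRingType) (p q : R) (n : nat) : R :=
  \sum_(j < n) p ^+ j * q ^+ (n - 1 - j).

(* Formal power series in t, as coefficient sequences. *)

Definition fps (R : comNzRingType) := nat -> R.

Section FormalPowerSeries.
Variable R : comNzRingType.
Implicit Types f g h : fps R.

Definition fps_one : fps R := fun n => (n == 0)%:R.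

Definition fps_sub f g : fps R := fun n => f n - g n.

Definition fps_mul f g : fps R := fun n => \sum_(i < n.+1) f i * g (n - i)%N.

Definition fps_exp f k : fps R := iter k (fps_mul f) fps_one.

(* 1/f for f with constant coefficient 1, as the geometric series
   \sum_k (1 - f)^k; the powers k > n do not contribute to t^n. *)
Definition fps_inv f : fps R :=
  fun n => \sum_(k < n.+1) fps_exp (fps_sub fps_one f) k n.

(* 1 - c t - b t^2 h(t) *)
Definition jdenom (c b : R) h : fps R :=
  fun n => match n with 0 => 1 | 1 => - c | m.+2 => - (b * h m) end.

(* The finite J-fraction
     1 / (1 - gam_k t - bet_{k+1} t^2 / (1 - gam_{k+1} t - ...
          - bet_{k+m} t^2 / (1 - gam_{k+m} t))). *)
Fixpoint jconvergent (gam bet : nat -> R) (m k : nat) : fps R :=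
  match m with
  | 0 => fps_inv (jdenom (gam k) 0 (fun=> 0))
  | m'.+1 => fps_inv (jdenom (gam k) (bet k.+1) (jconvergent gam bet m' k.+1))
  end.

(* Convergence for the t-adic topology: each coefficient is eventually
   constant. *)
Definition fps_cvg (u : nat -> fps R) f : Prop :=
  forall n, exists M, forall m, (M <= m)%N -> u m n = f n.

(* f is the value of the infinite J-fraction
     1 / (1 - gam_0 t - bet_1 t^2 / (1 - gam_1 t - bet_2 t^2 / ...));
   bet 0 is not used. *)
Definition jfraction (gam bet : nat -> R) f : Prop :=
  fps_cvg (fun m => jconvergent gam bet m 0) f.

Lemma fps_exp_small f k n : f 0%N = 0 -> (n < k)%N -> fps_exp f k n = 0.
Proof.
move=> f0; elim: k n => [|k IHk] n // lt_nk.
rewrite /fps_exp iterS -/(fps_exp f k) /fps_mul big1 // => -[[|i] lt_in] _ /=.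
  by rewrite f0 mul0r.
rewrite IHk ?mulr0 // ltn_subLR //.
by rewrite (leq_trans lt_nk) // addSn ltnS leq_addl.
Qed.

Lemma fps_mulV f : f 0%N = 1 -> fps_mul f (fps_inv f) =1 fps_one.
Proof.
move=> f0 n; set g := fps_sub fps_one f.
have g0 : g 0%N = 0 by rewrite /g /fps_sub /fps_one f0 subrr.
have fE i : f i = fps_one i - g i by rewrite /g /fps_sub opprB addrC subrK.
have invE m : (m <= n)%N -> fps_inv f m = \sum_(k < n.+1) fps_exp g k m.
  move=> le_mn; rewrite /fps_inv -/g.
  rewrite -!(big_mkord xpredT (fun k => fps_exp g k m)).
  rewrite [RHS](big_cat_nat (n := m.+1)) //= [X in _ + X]big1_seq ?addr0 //.
  move=> k; rewrite mem_index_iota => /andP[_ /andP[lt_mk _]].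
  exact: fps_exp_small.
have -> : fps_mul f (fps_inv f) n =
          fps_inv f n - \sum_(k < n.+1) fps_exp g k.+1 n.
  rewrite /fps_mul.
  under eq_bigr => i _ do rewrite fE mulrBl.
  rewrite sumrB; congr (_ - _).
    rewrite big_ord_recl /= subn0 mul1r big1 ?addr0 // => i _.
    by rewrite /fps_one /= mul0r.
  under eq_bigr => i _ do rewrite invE ?leq_subr // mulr_sumr.
  by rewrite exchange_big.
rewrite invE // -sumrB.
rewrite -(big_mkord xpredT (fun k => fps_exp g k n - fps_exp g k.+1 n)).
under eq_bigr => i _ do rewrite -opprB.
by rewrite sumrN telescope_sumr // opprB [X in _ - X]fps_exp_small // subr0.
Qed.

End FormalPowerSeries.

(* A partition of [n] is P : {set {set 'I_n}} with partition P [set: 'I_n];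
   the index i : 'I_n stands for the element i + 1 of {1, ..., n}. *)

Section SetPartitionStatistics.
Variables (n : nat) (P : {set {set 'I_n}}).
Implicit Types i j k l : 'I_n.

Definition is_min i := [forall j : 'I_n in pblock P i, (i <= j)%N].
Definition is_max i := [forall j : 'I_n in pblock P i, (j <= i)%N].

Definition singleton i := #|pblock P i| == 1%N.
Definition opener i := (2 <= #|pblock P i|)%N && is_min i.
Definition closer i := (2 <= #|pblock P i|)%N && is_max i.
Definition insider i :=
  [&& (3 <= #|pblock P i|)%N, ~~ opener i & ~~ closer i].

(* The edges (i, j), i < j, of the graph G_P. *)
Definition edge i j :=
  [&& (i < j)%N, j \in pblock P i &
      [forall k : 'I_n in pblock P i, ~~ ((i < k)%N && (k < j)%N)]].

(* The values are the labels j + 1 in {1, ..., n}, so that 0 is below all of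
   them. *)
Definition sigma' i : nat :=
  if [pick j | edge i j] is Some j then j.+1 else 0%N.

Definition exclusive_record i :=
  (sigma' i != 0)%N && [forall j : 'I_n, (j < i)%N ==> (sigma' j < sigma' i)%N].

Definition m1 := #|[set i | singleton i]|.
Definition mge2 := #|[set B in P | (2 <= #|B|)%N]|.
Definition erecin := #|[set i | insider i & exclusive_record i]|.
Definition erecop := #|[set i | opener i & exclusive_record i]|.
Definition nerecin := #|[set i | insider i & ~~ exclusive_record i]|.
Definition nerecop := #|[set i | opener i & ~~ exclusive_record i]|.

Definition crossing i j k l :=
  [&& (i < j)%N, (j < k)%N, (k < l)%N, edge i k & edge j l].
Definition nesting i j k l :=
  [&& (i < j)%N, (j < k)%N, (k < l)%N, edge i l & edge j k].

Definition num_quad (Q : 'I_n -> 'I_n -> 'I_n -> 'I_n -> bool) : nat :=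
  #|[set u : 'I_n * 'I_n * 'I_n * 'I_n |
      let: (i, j, k, l) := u in Q i j k l]|.

Definition crin := num_quad (fun i j k l => crossing i j k l && insider j).
Definition crop := num_quad (fun i j k l => crossing i j k l && opener j).
Definition nein := num_quad (fun i j k l => nesting i j k l && insider j).
Definition neop := num_quad (fun i j k l => nesting i j k l && opener j).

Definition psne : nat :=
  #|[set u : 'I_n * 'I_n * 'I_n |
      let: (i, j, l) := u in
      [&& (i < j)%N, (j < l)%N, singleton j & edge i l]]|.

End SetPartitionStatistics.

Definition Bpoly (R : comNzRingType)
    (x1 x2 y1 y2 v1 v2 p1 p2 q1 q2 r : R) (n : nat) : R :=
  \sum_(P : {set {set 'I_n}} | partition P [set: 'I_n])
    x1 ^+ m1 P * x2 ^+ mge2 P *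
    y1 ^+ erecin P * y2 ^+ erecop P *
    v1 ^+ nerecin P * v2 ^+ nerecop P *
    p1 ^+ crin P * p2 ^+ crop P *
    q1 ^+ nein P * q2 ^+ neop P * r ^+ psne P.

(* Main.v *)
Require Import Defs.
From mathcomp Require Import all_boot all_order all_algebra.
Set Implicit Arguments.
Unset Strict Implicit.
Unset Printing Implicit Defensive.
Import GRing.Theory.
Local Open Scope ring_scope.

(** A partition is the same thing as its arc diagram, the map that sends each
    element to the next one in its block, and the maximum of a block to
    itself ([block_next] and [diagram_partition] are inverse to each other).
    Scan the diagram from left to right.  Before position i some arcs are
    pending: they start to the left of i and end at i or beyond, and the type
    of i is read off from whether a pending arc ends at i and whether an arc
    leaves i.

    All the statistics are local for this scan, because each can be counted by
    one element j: a block by its opener, a crossing, a nesting or a triplet by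
    its second entry.  An arc from j to k crosses the pending arcs that end
    strictly between j and k and is nested under those that end beyond k, and j
    is an exclusive record exactly when the second number is 0.  So the weight of
    a partition is a product over j of a factor depending only on the set T of
    pending endpoints at j and on k ([partition_weight]).

    Sum the weights of the diagrams restricted to [0, m) with prescribed set S
    of pending endpoints.  Removing the last element o = m - 1 turns S into
    S minus k, with o added if some arc ends at o.  When k runs through S, its
    number of predecessors in S runs through 0, ..., |S| - 1, so the factors of
    o sum to p ^ (h-1) y + q [h-1]_{p,q} v with h = |S|: this is gam_h without its
    singleton term r ^ h x1 if o is an insider, and bet_h / x2 if o is an opener,
    which also brings a factor x2.
    Hence the sum depends on S only through h, and counts Motzkin paths from
    height 0 to height h with level weight gam and rise weight bet
    ([prefix_sumE]).

    Flajolet's theorem then gives the continued fraction.  If H_k is the tail of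
    the fraction that starts at gam_k, the paths ending at height k have the
    generating series bet_1 ... bet_k t^k H_0 ... H_k, because this family
    satisfies the same recursion on the last step ([motzkin_level_series]). *)

(** * Motzkin paths and J-fractions *)

Section PowerSeries.
Variable R : comNzRingType.
Implicit Types f g h : fps R.

(** Truncation to a polynomial transfers the ring laws of [{poly R}] to the
    products of coefficient sequences. *)
Definition trunc (n : nat) f : {poly R} := \poly_(i < n.+1) f i.

Lemma coef_trunc n f i : (i <= n)%N -> (trunc n f)`_i = f i.
Proof. by move=> le_in; rewrite coef_poly ltnS le_in. Qed.

Lemma fps_mul_trunc n m f g : (m <= n)%N ->
  fps_mul f g m = (trunc n f * trunc n g)`_m.
Proof.
move=> le_mn; rewrite coefM; apply: eq_bigr => i _.
by rewrite !coef_trunc ?(leq_trans (leq_subr _ _)) // (leq_trans _ le_mn) // -ltnS.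
Qed.

Lemma eq_fps_mul f f' g g' : f =1 f' -> g =1 g' -> fps_mul f g =1 fps_mul f' g'.
Proof. by move=> ff' gg' n; apply: eq_bigr => i _; rewrite ff' gg'. Qed.

Lemma fps_mulC f g : fps_mul f g =1 fps_mul g f.
Proof. by move=> n; rewrite !(@fps_mul_trunc n) // mulrC. Qed.

Lemma fps_mulA f g h : fps_mul f (fps_mul g h) =1 fps_mul (fps_mul f g) h.
Proof.
move=> n; rewrite !(@fps_mul_trunc n) //.
transitivity ((trunc n f * (trunc n g * trunc n h))`_n).
  rewrite 2!coefM; apply: eq_bigr => i _; congr (_ * _).
  by rewrite coef_trunc ?leq_subr // (@fps_mul_trunc n) ?leq_subr.
rewrite mulrA 2!coefM; apply: eq_bigr => i _; congr (_ * _).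
have le_in : (i <= n)%N by rewrite -ltnS.
by rewrite coef_trunc // (@fps_mul_trunc n).
Qed.

Lemma fps_mul1 f : fps_mul f (fps_one R) =1 f.
Proof.
move=> n; rewrite fps_mulC /fps_mul big_ord_recl /= subn0 mul1r.
by rewrite big1 ?addr0 // => i _; rewrite /fps_one mul0r.
Qed.

(** The series b t f. *)
Definition fps_shift (b : R) f : fps R := fun n => if n is m.+1 then b * f m else 0.

Lemma fps_mul_shift b f g : fps_mul (fps_shift b f) g =1 fps_shift b (fps_mul f g).
Proof.
move=> [|n]; first by rewrite /fps_mul big_ord1 mul0r.
rewrite /fps_mul /= big_ord_recl mul0r add0r mulr_sumr.
by apply: eq_bigr => i _; rewrite mulrA.
Qed.

Lemma jdenom_mul c b h f n :
  fps_mul (jdenom c b h) f n =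
  f n - c * (if n is m.+1 then f m else 0)
      - b * (if n is m.+2 then fps_mul h f m else 0).
Proof.
rewrite /fps_mul big_ord_recl subn0 mul1r.
case: n => [|[|n]]; first by rewrite big_ord0 !mulr0 !subr0 addr0.
  by rewrite big_ord1 /= mulNr mulr0 subr0.
rewrite big_ord_recl /= mulNr subSS subn0 addrA; congr (_ + _).
by rewrite mulr_sumr -sumrN; apply: eq_bigr => i _; rewrite mulNr mulrA.
Qed.

Variables gam bet : nat -> R.

(** Weighted Motzkin paths of n steps from height 0 to height k, sorted by their
    last step: level at height h has weight [gam h], a rise to height h has
    weight [bet h], and a fall has weight 1. *)
Fixpoint motzkin (n k : nat) : R :=
  if n is m.+1 then
    gam k * motzkin m k + motzkin m k.+1
    + (if k is l.+1 then bet k * motzkin m l else 0)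
  else (k == 0)%:R.

(** The part of the m-th convergent that starts at [gam k]; it is a finite
    J-fraction of depth m - k. *)
Definition jtail (m k : nat) := jconvergent gam bet (m - k) k.

(** The product bet_1 ... bet_k t^k H_0 ... H_k of the successive tails: a path
    from height 0 to height k factors at its last visits of 0, 1, ..., k - 1. *)
Fixpoint level_series (m k : nat) : fps R :=
  if k is l.+1 then fps_mul (fps_shift (bet k) (level_series m l)) (jtail m k)
  else jtail m 0.

Lemma jtail_inv m k : (k < m)%N ->
  fps_mul (jdenom (gam k) (bet k.+1) (jtail m k.+1)) (jtail m k) =1 fps_one R.
Proof.
move=> lt_km; rewrite [jtail m k]/jtail -subSS subSn //=; exact: fps_mulV.
Qed.

(** The last factor H_k of the product cancels against its own denominator,
    which leaves bet_k t times the previous product. *)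
Lemma level_series_rec m k n : (k < m)%N ->
  fps_mul (jdenom (gam k) (bet k.+1) (jtail m k.+1)) (level_series m k) n =
  if k is l.+1 then fps_shift (bet k) (level_series m l) n else fps_one R n.
Proof.
case: k => [|k] lt_km /=; first exact: jtail_inv.
rewrite fps_mulC -fps_mulA -[RHS]fps_mul1; apply: eq_fps_mul => // i.
by rewrite fps_mulC jtail_inv.
Qed.

(** The recursion from (n, k) only reaches heights at most n + k, so cutting the
    fraction at depth m >= n + k does not change this coefficient. *)
Lemma motzkin_level_series m n k : (n + k <= m)%N -> motzkin n k = level_series m k n.
Proof.
elim: n k => [|n IHn] k le_nk.
  case: k le_nk => [|k] le_nk /=.
    case: m le_nk => [|m] _ /=; rewrite /jtail /= /fps_inv big_ord1 /=;
    by rewrite /fps_one.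
  by rewrite fps_mul_shift.
have lt_km : (k < m)%N by rewrite (leq_trans _ le_nk) // ltnS leq_addl.
have := level_series_rec n.+1 lt_km; rewrite jdenom_mul => E.
have {E} -> : level_series m k n.+1 =
  gam k * level_series m k n
  + bet k.+1 * (if n is n'.+1 then fps_mul (jtail m k.+1) (level_series m k) n' else 0)
  + if k is l.+1 then fps_shift (bet k) (level_series m l) n.+1 else fps_one R n.+1.
  by rewrite -E addrC [X in _ + X]addrC addrA !subrK.
rewrite /= IHn ?IHn; last by rewrite (leq_trans _ le_nk).
  congr (_ + _ + _).
    by rewrite /= fps_mul_shift; case: (n) => [|i] /=; rewrite ?mulr0 // fps_mulC.
  by case: k le_nk {lt_km} => // k le_nk /=;
    rewrite IHn // (leq_trans _ le_nk) // addnS leqW.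
by rewrite addnS.
Qed.

(** Flajolet's theorem: closed Motzkin paths are counted by the J-fraction. *)
Lemma motzkin_jfraction f : (forall n, f n = motzkin n 0) -> jfraction gam bet f.
Proof.
move=> fE n; exists n => m le_nm; rewrite fE (@motzkin_level_series m) ?addn0 //.
by rewrite /= /jtail subn0.
Qed.

End PowerSeries.

(** * Weights of arcs summed over their right ends *)

Section Ranks.
Variable n : nat.

Lemma card_below_above (S : {set 'I_n}) (v : 'I_n) : v \in S ->
  (#|[set l in S | (l < v)%N]| + #|[set l in S | (v < l)%N]|)%N = #|S|.-1.
Proof.
move=> vS; rewrite (cardsD1 v S) vS add1n /= -(cardsID [set l : 'I_n | (l < v)%N] (S :\ v)).
by congr (_ + _)%N; apply: eq_card => l; rewrite !inE;
  case: (l \in S); rewrite ?andbF // ?andbT /= -(inj_eq val_inj); case: ltngtP.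
Qed.

(** The number of predecessors is a bijection from S to 0, ..., |S| - 1: remove
    the largest element of S, which has the largest rank. *)
Lemma sum_over_ranks (R : comNzRingType) (psi : nat -> R) (S : {set 'I_n}) :
  \sum_(v in S) psi #|[set l in S | (l < v)%N]| = \sum_(i < #|S|) psi i.
Proof.
have [k] := ubnP #|S|; elim: k S => // k IHk S; rewrite ltnS => le_Sk.
have [->|[v0 v0S]] := set_0Vmem S; first by rewrite big_set0 cards0 big_ord0.
case: (arg_maxnP (fun v : 'I_n => v : nat) v0S) => m mS0 max_m; have mS : m \in S := mS0.
have cardS : #|S| = #|S :\ m|.+1 by rewrite (cardsD1 m S) mS.
rewrite (big_setD1 m) //= cardS big_ord_recr /= addrC -IHk; last by rewrite -cardS.
congr (_ + _).
  apply: eq_bigr => v; rewrite !inE => /andP[v_m vS]; congr psi; apply: eq_card => l.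
  rewrite !inE; case: (l =P m) => [->|] //=; rewrite mS /=; apply/negbTE.
  by rewrite -leqNgt; apply: max_m.
congr psi; apply: eq_card => l; rewrite !inE andbC -(inj_eq val_inj) /=.
by case lS: (l \in S); rewrite ?andbF // !andbT; have /= := max_m _ lS; case: ltngtP.
Qed.

End Ranks.

Section ArcWeights.
Variables (R : comNzRingType).

(** The factor of an arc that makes c crossings and m nestings with the arcs
    pending at its left end; the left end is an exclusive record if m = 0. *)
Definition arc_weight (p q y v : R) (c m : nat) : R :=
  p ^+ c * q ^+ m * (if m == 0%N then y else v).

Lemma sum_arc_weight p q y v k :
  \sum_(i < k.+1) arc_weight p q y v i (k - i)%N = p ^+ k * y + q * pqnum p q k * v.
Proof.
rewrite big_ord_recr /= {2}/arc_weight subnn expr0 mulr1 eqxx addrC; congr (_ + _).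
rewrite /pqnum mulr_sumr mulr_suml; apply: eq_bigr => i _.
rewrite /arc_weight subn_eq0 leqNgt ltn_ord /= subnAC subn1; congr (_ * _).
have : (0 < k - i)%N by rewrite subn_gt0.
by case: (k - i)%N => // a _; rewrite exprS mulrCA.
Qed.

Lemma sum_arc_weight_set n (S : {set 'I_n}) p q y v : S != set0 ->
  \sum_(a in S) arc_weight p q y v #|[set l in S | (l < a)%N]| #|[set l in S | (a < l)%N]|
  = p ^+ (#|S| - 1) * y + q * pqnum p q (#|S| - 1) * v.
Proof.
rewrite -card_gt0; case cS: #|S| => [//|k] _; rewrite subn1 /= -sum_arc_weight -cS.
rewrite -(sum_over_ranks (fun i => arc_weight p q y v i (k - i)%N)).
by apply: eq_bigr => a /card_below_above; rewrite cS /= => <-; rewrite addKn.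
Qed.

End ArcWeights.


(** * Arc diagrams and their prefixes *)

Section ArcDiagrams.
Variable n : nat.
Implicit Types (F G : {ffun 'I_n -> 'I_n}) (S T : {set 'I_n}) (i j k l o v : 'I_n).

(** Arc diagrams in the form i |-> F i; a fixed point encodes the absence of an
    arc, so that the condition of injectivity concerns only the other points. *)
Definition arc_map F :=
  [forall i : 'I_n, (i <= F i)%N] &&
  [forall i : 'I_n, forall k : 'I_n,
     [&& (i < F i)%N, (k < F k)%N & F i == F k] ==> (i == k)].

Lemma arc_mapP F :
  reflect ((forall i, i <= F i)%N /\
           (forall i k, i < F i -> k < F k -> F i = F k -> i = k)%N) (arc_map F).
Proof.
apply: (iffP andP) => [[/forallP leF /forallP injF]|[leF injF]].
  split=> // i k lti ltk Fik; apply/eqP.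
  by have /forallP/(_ k)/implyP := injF i; apply; rewrite lti ltk Fik eqxx.
split; apply/forallP => // i; apply/forallP => k; apply/implyP.
by case/and3P => lti ltk /eqP Fik; apply/eqP; apply: injF.
Qed.

(** The right ends, at m or beyond, of the arcs that start before m. *)
Definition pending F (m : nat) : {set 'I_n} :=
  [set l : 'I_n | [exists i : 'I_n, [&& (i < m)%N, (m <= l)%N & F i == l]]].

Lemma pendingP F m l :
  reflect (exists i : 'I_n, [/\ (i < m)%N, (m <= l)%N & F i = l]) (l \in pending F m).
Proof.
rewrite inE; apply: (iffP existsP) => [[i /and3P[? ? /eqP]]|[i [? ? /eqP ?]]];
  by exists i => //; apply/and3P.
Qed.

Definition supported_below F (m : nat) := [forall i : 'I_n, (m <= i)%N ==> (F i == i)].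

Lemma supportedP F m :
  reflect (forall i, (m <= i)%N -> F i = i) (supported_below F m).
Proof.
by apply: (iffP forallP) => H i; [move/(implyP (H i))/eqP | apply/implyP => /H ->].
Qed.

Definition prefix_diagram m S F :=
  [&& arc_map F, supported_below F m & pending F m == S].

Definition redirect F o v : {ffun 'I_n -> 'I_n} := [ffun i => if i == o then v else F i].

Lemma redirectE F o v i : redirect F o v i = if i == o then v else F i.
Proof. by rewrite ffunE. Qed.

Lemma eq_pending F G m : (forall i, (i < m)%N -> F i = G i) -> pending F m = pending G m.
Proof.
move=> FG; apply/setP => l.
by apply/pendingP/pendingP => -[i [lt_im le_ml Fi]]; exists i; split=> //; rewrite -Fi FG.
Qed.

Lemma pending_redirect F o v : pending (redirect F o v) o = pending F o.
Proof.
by apply: eq_pending => i lt_io; rewrite redirectE; case: eqP lt_io => // ->; rewrite ltnn.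
Qed.

(** A diagram on [0, o] with F o = v arises from a unique diagram G on [0, o).
    The right ends pending at o for G are those in S other than v, which is the
    end of the arc leaving o, and o itself if an arc ends there. *)
Lemma redirect_diagram S G o v (b : bool) :
    (forall l, l \in S -> (o < l)%N) -> (v == o) || (v \in S) ->
  [&& prefix_diagram o.+1 S (redirect G o v), redirect G o v o == v,
      (o \in pending (redirect G o v) o) == b
    & redirect (redirect G o v) o o == G] =
  prefix_diagram o (if b then o |: (S :\ v) else S :\ v) G.
Proof.
move=> ltS vS; rewrite pending_redirect redirectE !eqxx /=.
have le_ov : (o <= v)%N by case/orP: vS => [/eqP->|/ltS/ltnW].
have oS : o \notin S by apply/negP => /ltS; rewrite ltnn.
have GoE : (redirect (redirect G o v) o o == G) = (G o == o).
  apply/eqP/eqP => [<-|Goo]; first by rewrite redirectE eqxx.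
  by apply/ffunP => i; rewrite !redirectE; case: eqP => // ->.
rewrite {}GoE.
apply/and3P/and3P => [[/and3P[arcF supF /eqP penF] /eqP bE /eqP Goo]|[arcG supG /eqP penG]].
  case/arc_mapP: arcF => leF injF; have leG i : (i <= G i)%N.
    by have := leF i; rewrite redirectE; case: eqP => // ->; rewrite Goo.
  have Fo : redirect G o v o = v by rewrite redirectE eqxx.
  have FG i : i != o -> redirect G o v i = G i by rewrite redirectE => /negbTE->.
  split.
  - apply/arc_mapP; split=> // i k lti ltk.
    have io : i != o by apply: contraTneq lti => ->; rewrite Goo ltnn.
    have ko : k != o by apply: contraTneq ltk => ->; rewrite Goo ltnn.
    by move: (injF i k); rewrite !FG //; apply.
  - apply/supportedP => i le_oi; have [->//|io] := eqVneq i o.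
    rewrite -FG //; move/supportedP: supF; apply.
    by rewrite ltn_neqAle le_oi andbT eq_sym.
  apply/eqP/setP => l; have [->|lo] := eqVneq l o.
    by rewrite bE; case: (b); rewrite !inE ?eqxx //= (negbTE oS) andbF.
  have -> : (l \in if b then o |: S :\ v else S :\ v) = (l != v) && (l \in S).
    by case: (b); rewrite !inE ?(negbTE lo).
  apply/pendingP/andP => [[i [lt_io le_ol Gi]]|[lv]].
    have io : i != o by rewrite -(inj_eq val_inj) neq_ltn lt_io.
    have lt_ol : (o < l)%N by rewrite ltn_neqAle le_ol andbT eq_sym.
    split; last first.
      by rewrite -penF; apply/pendingP; exists i; rewrite FG //; split=> //; apply: ltnW.
    apply: contra (io) => /eqP lv; apply/eqP/injF; rewrite ?Fo ?FG ?Gi -?lv //.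
    by rewrite (ltn_trans lt_io).
  rewrite -penF => /pendingP[i [lt_io lt_ol]]; rewrite redirectE.
  have [_ vl|io Gi] := eqVneq i o; first by rewrite vl eqxx in lv.
  exists i; split=> //; last exact: ltnW.
  by rewrite ltn_neqAle -ltnS lt_io andbT (inj_eq val_inj).
have Goo : G o = o by move/supportedP: supG; apply.
case/arc_mapP: arcG => leG injG.
have Fo : redirect G o v o = v by rewrite redirectE eqxx.
have FG i : i != o -> redirect G o v i = G i by rewrite redirectE => /negbTE->.
have vT : (o < v)%N -> v \notin pending G o.
  move=> lt_ov; rewrite penG; case: (b); rewrite !inE ?eqxx //= orbF.
  by rewrite -(inj_eq val_inj) neq_ltn lt_ov orbT.
have noG i : i != o -> (i < G i)%N -> (o < v)%N -> G i != v.
  move=> io ltG lt_ov; apply: contra (vT lt_ov) => /eqP Gi.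
  apply/pendingP; exists i; split=> //.
  rewrite ltnNge; apply/negP => le_oi; move/supportedP: supG => /(_ i le_oi) GiE.
  by rewrite GiE ltnn in ltG.
split; last by apply/eqP.
  apply/and3P; split.
  - apply/arc_mapP; split=> [i|i k].
      by rewrite redirectE; case: eqP => // ->.
    have [->|io] := eqVneq i o; have [->|ko] := eqVneq k o; rewrite ?Fo ?FG //.
    + by move=> lt_ov lt_kG vE; have := noG k ko lt_kG lt_ov; rewrite vE eqxx.
    + by move=> lt_iG lt_ov vE; have := noG i io lt_iG lt_ov; rewrite vE eqxx.
    exact: injG.
  - apply/supportedP => i lt_oi; have io : i != o.
      by rewrite -(inj_eq val_inj) neq_ltn lt_oi orbT.
    by rewrite FG //; move/supportedP: supG; apply; apply: ltnW.
  apply/eqP/setP => l; apply/pendingP/idP => [[i [le_io lt_ol]]|lS].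
    have [->|io] := eqVneq i o; rewrite ?Fo ?FG //.
      by move=> vl; move: vS lt_ol; rewrite vl => /orP[/eqP->|//]; rewrite ltnn.
    move=> Gi; have : l \in pending G o.
      apply/pendingP; exists i; split=> //; last exact: ltnW.
      by rewrite ltn_neqAle -ltnS le_io andbT (inj_eq val_inj).
    rewrite penG; case: (b); rewrite !inE; last by case/andP.
    by case/orP=> [/eqP lo|/andP[]//]; rewrite lo ltnn in lt_ol.
  have [lv|lv] := eqVneq l v.
    by exists o; rewrite Fo; split=> //; apply: ltS.
  have : l \in pending G o by rewrite penG; case: (b); rewrite !inE lv lS ?orbT.
  case/pendingP => i [lt_io le_ol Gi]; exists i; split.
  - exact: ltnW.
  - exact: ltS.
  by rewrite FG // -(inj_eq val_inj) neq_ltn lt_io.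
by rewrite penG; case: (b); rewrite !inE ?eqxx // (negbTE oS) andbF.
Qed.

End ArcDiagrams.

Section PrefixSums.
Variables (R : comNzRingType) (x1 x2 y1 y2 v1 v2 p1 p2 q1 q2 r : R) (n : nat).
Implicit Types (F G : {ffun 'I_n -> 'I_n}) (S T : {set 'I_n}) (i o v : 'I_n).

(** The factor of the element i when T is the set of right ends pending at i and
    the diagram sends i to v.  The four cases are, in order: a closer, a
    singleton, an insider and an opener. *)
Definition step_weight T i v : R :=
  let c := #|[set l in T | (i < l < v)%N]| in
  let m := #|[set l : 'I_n in T | (v < l)%N]| in
  if v == i then
    if i \in T then 1 else x1 * r ^+ #|[set l : 'I_n in T | (i < l)%N]|
  else
    if i \in T then arc_weight p1 q1 y1 v1 c m else x2 * arc_weight p2 q2 y2 v2 c m.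

Definition prefix_weight (m : nat) F : R :=
  \prod_(i : 'I_n | (i < m)%N) step_weight (pending F i) i (F i).

Definition prefix_sum (m : nat) S : R :=
  \sum_(F | prefix_diagram m S F) prefix_weight m F.

Lemma prefix_sum0 S : prefix_sum 0 S = (#|S| == 0%N)%:R.
Proof.
rewrite /prefix_sum cards_eq0.
have pen0 F : pending F 0 = set0.
  by apply/setP => l; rewrite in_set0; apply/pendingP => -[i []].
have [->|S0] := eqVneq S set0; last first.
  by rewrite big_pred0 // => F; rewrite /prefix_diagram pen0 eq_sym (negbTE S0) !andbF.
rewrite (big_pred1 [ffun i => i]) => [|F]; first by rewrite /prefix_weight big_pred0.
rewrite /prefix_diagram pen0 eqxx andbT; apply/andP/eqP => [[_ /supportedP supF]|->].
  by apply/ffunP => i; rewrite ffunE supF.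
split; last by apply/supportedP => i _; rewrite ffunE.
by apply/arc_mapP; split=> [i|i k]; rewrite !ffunE // ltnn.
Qed.

(** The factor of an element before o depends only on arcs that start before o,
    so removing the arc of o splits off the factor of o and nothing else. *)
Lemma prefix_sum_fiber o v S (b : bool) :
    (forall l : 'I_n, l \in S -> (o < l)%N) -> (v == o) || (v \in S) ->
  let T := if b then o |: (S :\ v) else S :\ v in
  \sum_(F | (prefix_diagram o.+1 S F && (F o == v)) && ((o \in pending F o) == b))
     prefix_weight o.+1 F
  = step_weight T o v * prefix_sum o T.
Proof.
move=> ltS vS T; rewrite (reindex_onto (fun G => redirect G o v) (fun F => redirect F o o)).
  rewrite /prefix_sum mulr_sumr; apply: eq_big => [G|G GP].
    by rewrite /= -2!andbA redirect_diagram.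
  have pdG : prefix_diagram o T G by rewrite -redirect_diagram // 2!andbA.
  rewrite /prefix_weight (bigD1 o) //= pending_redirect redirectE eqxx.
  case/and3P: pdG => _ _ /eqP ->; congr (_ * _).
  apply: eq_big => [i|i /andP[lt_io io]].
    by rewrite ltnS ltn_neqAle andbC (inj_eq val_inj).
  rewrite redirectE (negbTE io); congr (step_weight _ _ _).
  apply: eq_pending => k lt_ki; rewrite redirectE; case: eqP => // ko.
  by rewrite ltnNge ko -ltnS lt_io in lt_ki.
move=> F /andP[/andP[_ /eqP Fo] _]; apply/ffunP => i; rewrite !redirectE.
by case: eqP => // ->.
Qed.

(** The three groups of terms: o is a closer, o is a singleton, or an arc goes
    from o to v in S, where o is an insider or an opener. *)
Lemma prefix_sum_rec o S : (forall l : 'I_n, l \in S -> (o < l)%N) ->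
  prefix_sum o.+1 S =
  prefix_sum o (o |: S) + x1 * r ^+ #|S| * prefix_sum o S
  + \sum_(v in S)
      (arc_weight p1 q1 y1 v1 #|[set l : 'I_n in S | (l < v)%N]|
           #|[set l : 'I_n in S | (v < l)%N]|
         * prefix_sum o (o |: (S :\ v))
     + x2 * arc_weight p2 q2 y2 v2 #|[set l : 'I_n in S | (l < v)%N]|
           #|[set l : 'I_n in S | (v < l)%N]|
         * prefix_sum o (S :\ v)).
Proof.
move=> ltS; have oS : o \notin S by apply/negP => /ltS; rewrite ltnn.
rewrite {1}/prefix_sum (partition_big (fun F => F o) (fun v => v \in o |: S)) /=; last first.
  move=> F /and3P[/arc_mapP[leF _] _ /eqP penF]; rewrite !inE; case: eqP => //= Fo.
  rewrite -penF; apply/pendingP; exists o; split=> //.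
  by rewrite ltn_neqAle leF andbT (inj_eq val_inj) eq_sym; apply/eqP.
have fiber v : v \in o |: S ->
    \sum_(F | prefix_diagram o.+1 S F && (F o == v)) prefix_weight o.+1 F =
    step_weight (o |: (S :\ v)) o v * prefix_sum o (o |: (S :\ v)) +
    step_weight (S :\ v) o v * prefix_sum o (S :\ v).
  rewrite !inE => vS.
  rewrite (partition_big (fun F => o \in pending F o) xpredT) //= big_bool /=.
  by rewrite (prefix_sum_fiber true) // (prefix_sum_fiber false).
rewrite big_setU1 //= fiber ?setU11 //; congr (_ + _).
  have -> : S :\ o = S by apply/setP => l; rewrite !inE; case: eqP oS => //= -> /negbTE->.
  rewrite /step_weight eqxx setU11 mul1r (negbTE oS); congr (_ + _ * _ ^+ _ * _).
  by apply: eq_card => l; rewrite !inE; case lS: (l \in S); rewrite //= ltS.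
apply: eq_bigr => v vS; rewrite fiber; last by rewrite !inE vS orbT.
have lt_ov := ltS v vS; have vo : v != o by rewrite -(inj_eq val_inj) neq_ltn lt_ov orbT.
have below T : T \in [:: o |: S :\ v; S :\ v] ->
    #|[set l in T | (o < l < v)%N]| = #|[set l : 'I_n in S | (l < v)%N]|.
  rewrite !inE => TE; apply: eq_card => l; rewrite !inE.
  have -> : (l \in T) && (o < l < v)%N = (l != v) && (l \in S) && (o < l < v)%N.
    case/orP: TE => /eqP->; rewrite !inE //; have [->|] := eqVneq l o; rewrite ?ltnn ?andbF //.
  have [->|lv] := eqVneq l v; first by rewrite ltnn !andbF.
  by case lS: (l \in S); rewrite //= ltS.
have above T : T \in [:: o |: S :\ v; S :\ v] ->
    #|[set l : 'I_n in T | (v < l)%N]| = #|[set l : 'I_n in S | (v < l)%N]|.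
  rewrite !inE => TE; apply: eq_card => l; rewrite !inE.
  case: (ltnP v l) => [lt_vl|]; rewrite ?andbF // !andbT.
  have lv : l != v by rewrite -(inj_eq val_inj) neq_ltn lt_vl orbT.
  have lo : l != o by rewrite -(inj_eq val_inj) neq_ltn (ltn_trans lt_ov) ?orbT.
  by case/orP: TE => /eqP->; rewrite !inE ?(negbTE lo) lv.
rewrite /step_weight (negbTE vo) setU11 !inE (negbTE oS) andbF.
by rewrite (below (o |: _)) ?(above (o |: _)) ?(below (S :\ v)) ?(above (S :\ v))
  ?inE ?eqxx ?orbT.
Qed.

Variables gam bet : nat -> R.
Hypothesis gam0 : gam 0 = x1.
Hypothesis gamE : forall k, (1 <= k)%N ->
  gam k = r ^+ k * x1 + p1 ^+ (k - 1) * y1 + q1 * pqnum p1 q1 (k - 1) * v1.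
Hypothesis betE : forall k, (1 <= k)%N ->
  bet k = x2 * (p2 ^+ (k - 1) * y2 + q2 * pqnum p2 q2 (k - 1) * v2).

(** By induction the prefix sums on the right of [prefix_sum_rec] depend only on
    the number of pending ends, and the sum over v becomes a sum over ranks. *)
Lemma prefix_sumE m S : (m <= n)%N -> (forall l : 'I_n, l \in S -> (m <= l)%N) ->
  prefix_sum m S = motzkin gam bet m #|S|.
Proof.
elim: m S => [|m IHm] S le_mn leS; first exact: prefix_sum0.
pose o := Ordinal le_mn; have ltS l : l \in S -> (o < l)%N by apply: leS.
have oS : o \notin S by apply/negP => /ltS; rewrite ltnn.
have IH T : (forall l, l \in T -> l = o \/ l \in S) ->
    prefix_sum m T = motzkin gam bet m #|T|.
  by move=> TS; apply: IHm (ltnW le_mn) _ => l /TS[->|/ltS/ltnW].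
rewrite -[m.+1]/(o.+1) prefix_sum_rec //= !IH; try by move=> l; rewrite ?inE; auto.
  rewrite cardsU1 oS add1n [X in X + _ = _]addrC.
  have [->|S0] := eqVneq S set0.
    by rewrite big_set0 cards0 !addr0 expr0 mulr1 gam0.
  have S1 : (1 <= #|S|)%N by rewrite card_gt0.
  under eq_bigr => v vS.
    have cSv : #|S :\ v| = (#|S| - 1)%N by rewrite (cardsD1 v S) vS add1n subn1.
    rewrite !IH; last first.
    - by move=> l; rewrite !inE => /predU1P[|/andP[]]; auto.
    - by move=> l; rewrite !inE => /andP[]; auto.
    rewrite cardsU1 !inE (negbTE oS) andbF cSv add1n subn1 prednK // -subn1.
    over.
  rewrite big_split /= -!mulr_suml -mulr_sumr !sum_arc_weight_set //.
  rewrite -betE //; move: S1 (gamE S1); case: #|S| => // k _ ->.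
  by rewrite subn1 /= !mulrDl [x1 * _]mulrC -!addrA; congr (_ + _);
    rewrite addrCA; congr (_ + _); rewrite addrCA.
by move=> l; rewrite !inE => /predU1P.
Qed.

End PrefixSums.

(** * Partitions as arc diagrams *)

Section Root.
Variable n : nat.
Implicit Types (F : {ffun 'I_n -> 'I_n}) (i j k l : 'I_n).

(** The maximum of the block of i: any chain of arcs stops within n steps. *)
Definition root F i := iter n F i.

Definition diagram_partition F : {set {set 'I_n}} := preim_partition (root F) [set: 'I_n].

Lemma iter_fixed F i m : F i = i -> iter m F i = i.
Proof. by move=> Fi; elim: m => //= m ->. Qed.

Lemma iter_arc_ge F i m : arc_map F -> (i <= iter m F i)%N.
Proof. by case/arc_mapP => leF _; elim: m => //= m /leq_trans; apply. Qed.

Lemma root_fixed F i : arc_map F -> F (root F i) = root F i.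
Proof.
case/arc_mapP => leF _; apply/eqP/negPn/negP => nfix.
suff lt_m m : (m <= n -> m <= iter m F i)%N.
  by have := lt_m n (leqnn n); rewrite leqNgt ltn_ord.
elim: m => // m IHm lt_mn; apply: leq_ltn_trans (IHm (ltnW lt_mn)) _.
rewrite iterS ltn_neqAle leF andbT (inj_eq val_inj); apply: contra nfix => /eqP fixm.
suff fix_after a : iter (a + m) F i = iter m F i.
  by rewrite /root -[in X in iter X](subnK (ltnW lt_mn)) fix_after -fixm.
by rewrite iterD iter_fixed.
Qed.

Lemma root_arc F i : arc_map F -> root F (F i) = root F i.
Proof. by move=> arcF; rewrite -[RHS]root_fixed // /root -iterSr. Qed.

Lemma last_arc F j k m : arc_map F -> (j < k)%N -> iter m F j = k ->
  exists z : 'I_n, [/\ (j <= z)%N, (z < F z)%N & F z = k].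
Proof.
move=> arcF lt_jk; have [leF _] := arc_mapP _ arcF.
elim: m => [jk|m IHm]; first by rewrite -jk ltnn in lt_jk.
have [/IHm//|nk mk] := eqVneq (iter m F j) k; exists (iter m F j).
rewrite -iterS mk; split=> //; first exact: iter_arc_ge.
by rewrite -mk iterS ltn_neqAle leF andbT (inj_eq val_inj) -iterS mk.
Qed.

(** By injectivity two chains of arcs that merge are one chain, so a block of the
    diagram is linearly ordered by following the arcs.  Starting from i < j, the
    arc of i cannot jump over j: otherwise j and F i lie in one chain by
    induction, and the last arc into F i starts at j or beyond, hence not at i. *)
Lemma eq_root_fconnect F i j : arc_map F ->
  root F i = root F j -> (i <= j)%N -> fconnect F i j.
Proof.
move=> arcF; have [leF injF] := arc_mapP _ arcF.
have [m] := ubnP (n - i); elim: m i j => // m IHm i j; rewrite ltnS => le_m eqr le_ij.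
have [->|ij] := eqVneq i j; first exact: connect0.
have lt_ij : (i < j)%N by rewrite ltn_neqAle le_ij (inj_eq val_inj) ij.
have lt_iF : (i < F i)%N.
  rewrite ltn_neqAle leF andbT (inj_eq val_inj) eq_sym; apply/eqP => Fi.
  have := iter_arc_ge j n arcF; rewrite -/(root F j) -eqr /root iter_fixed //.
  by rewrite leqNgt lt_ij.
have dec k : (i < k)%N -> (n - k < m)%N.
  by move=> lt_ik; apply: leq_trans le_m; rewrite ltn_sub2l // (leq_trans lt_ik) // ltnW.
case: (leqP (F i) j) => [le_Fj|lt_jF].
  apply: connect_trans (fconnect1 F i) (IHm _ _ (dec _ lt_iF) _ le_Fj).
  by rewrite root_arc.
have : iter (findex F j (F i)) F j = F i.
  apply: iter_findex.
  by apply: IHm (dec _ lt_ij) _ (ltnW lt_jF); rewrite root_arc.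
case/(last_arc arcF lt_jF) => z [le_jz lt_zF Fz].
by rewrite (injF z i lt_zF lt_iF Fz) leqNgt lt_ij in le_jz.
Qed.

Lemma diagram_partitionP F : partition (diagram_partition F) [set: 'I_n].
Proof. exact: preim_partitionP. Qed.

Lemma pblock_diagram F i j :
  (j \in pblock (diagram_partition F) i) = (root F i == root F j).
Proof.
rewrite pblock_equivalence_partition ?inE //.
by split=> // /eqP ->.
Qed.

End Root.

Section Next.
Variables (n : nat) (P : {set {set 'I_n}}).
Hypothesis partP : partition P [set: 'I_n].
Implicit Types (F : {ffun 'I_n -> 'I_n}) (i j k l : 'I_n).

Let tiP : trivIset P. Proof. by case/and3P: partP. Qed.

Lemma pblock_refl i : i \in pblock P i.
Proof. by rewrite mem_pblock (cover_partition partP) inE. Qed.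

Lemma pblock_same i j : j \in pblock P i -> pblock P j = pblock P i.
Proof. exact: same_pblock. Qed.

Definition block_next : {ffun 'I_n -> 'I_n} :=
  [ffun i => odflt i [pick j | edge P i j]].

Lemma edgeP i j :
  reflect [/\ (i < j)%N, j \in pblock P i &
              forall k, k \in pblock P i -> (i < k)%N -> (j <= k)%N]
          (edge P i j).
Proof.
apply: (iffP and3P) => -[lt_ij jP H]; split=> //.
  move=> k kP lt_ik; move/forallP/(_ k)/implyP/(_ kP): H.
  by rewrite lt_ik -leqNgt.
apply/forallP => k; apply/implyP => kP; apply/negP => /andP[/(H _ kP)].
by rewrite leqNgt => /negbTE->.
Qed.

Lemma edge_fun i j k : edge P i j -> edge P i k -> j = k.
Proof.
case/edgeP => lt_ij jP minj /edgeP[lt_ik kP mink].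
by apply/val_inj/eqP; rewrite eqn_leq minj ?mink.
Qed.

Lemma edge_inj i j k : edge P i k -> edge P j k -> i = j.
Proof.
wlog le_ij : i j / (i <= j)%N.
  by move=> H ei ej; case/orP: (leq_total i j) => ?; [|symmetry]; exact: H.
case/edgeP => lt_ik kP mini /edgeP[lt_jk kP' _]; apply/val_inj/eqP.
rewrite eqn_leq le_ij leqNgt; apply/negP => lt_ij.
suff /mini/(_ lt_ij) : j \in pblock P i by rewrite leqNgt lt_jk.
by rewrite -(pblock_same kP) (pblock_same kP') pblock_refl.
Qed.

Lemma is_maxPn i : reflect (exists j, edge P i j) (~~ is_max P i).
Proof.
apply: (iffP idP) => [|[j /edgeP[lt_ij jP _]]]; last first.
  by apply/negP => /forallP/(_ j)/implyP/(_ jP); rewrite leqNgt lt_ij.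
rewrite negb_forall => /existsP[j0]; rewrite negb_imply -ltnNge => j0P.
have [j /andP[jP lt_ij] minj] :=
  @arg_minnP _ j0 (fun j => (j \in pblock P i) && (i < j)%N) (fun j => j : nat) j0P.
by exists j; apply/edgeP; split=> // k kP lt_ik; apply: minj; rewrite kP.
Qed.

Lemma is_minPn i : reflect (exists j, edge P j i) (~~ is_min P i).
Proof.
apply: (iffP idP) => [|[j /edgeP[lt_ji iP _]]]; last first.
  apply/negP => /forallP/(_ j)/implyP; rewrite (pblock_same iP) pblock_refl.
  by rewrite leqNgt lt_ji => /(_ isT).
rewrite negb_forall => /existsP[j0]; rewrite negb_imply -ltnNge => j0P.
have [j /andP[jP lt_ji] maxj] :=
  @arg_maxnP _ j0 (fun j => (j \in pblock P i) && (j < i)%N) (fun j => j : nat) j0P.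
exists j; apply/edgeP; rewrite (pblock_same jP) pblock_refl; split=> // k kP lt_jk.
by rewrite leqNgt; apply/negP => lt_ki; have := maxj k;
  rewrite /= kP lt_ki leqNgt lt_jk => /(_ isT).
Qed.

Lemma nextP i : if is_max P i then block_next i = i else edge P i (block_next i).
Proof.
rewrite ffunE; case: pickP => [j eij|no] /=.
  by rewrite ifN //; apply/is_maxPn; exists j.
by case: ifPn => // /is_maxPn[j]; rewrite no.
Qed.

Lemma edge_lt i j : edge P i j -> (i < j)%N.
Proof. by case/edgeP. Qed.

Lemma is_max_next i : is_max P i = (block_next i == i).
Proof.
have := nextP i; case: ifP => [_ ->|_ /edge_lt lt_i]; first by rewrite eqxx.
by apply/esym/negbTE; rewrite -(inj_eq val_inj) neq_ltn lt_i orbT.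
Qed.

Lemma edge_next i j : edge P i j = (i < j)%N && (block_next i == j).
Proof.
apply/idP/andP => [eij|[lt_ij /eqP nij]].
  have := nextP i; rewrite ifN; last by apply/is_maxPn; exists j.
  by move/(edge_fun eij) <-; rewrite (edge_lt eij).
have := nextP i; case: ifP => _; rewrite nij // => ji.
by rewrite ji ltnn in lt_ij.
Qed.

Lemma arc_map_next : arc_map block_next.
Proof.
apply/arc_mapP; split=> [i|i k lti ltk eik].
  by have := nextP i; case: ifP => [_ ->|_ /edge_lt/ltnW].
apply: (@edge_inj _ _ (block_next i)); first by rewrite edge_next lti eqxx.
by rewrite edge_next eik ltk eqxx.
Qed.

Lemma mem_root i : root block_next i \in pblock P i.
Proof.
rewrite /root; move: (n in iter n) => m; elim: m => [|m IHm] /=; first exact: pblock_refl.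
rewrite -(pblock_same IHm); have := nextP (iter m block_next i).
by case: ifP => [_ ->|_ /edgeP[]//]; exact: pblock_refl.
Qed.

Lemma root_max i j : j \in pblock P i -> (j <= root block_next i)%N.
Proof.
move=> jP; have : is_max P (root block_next i) by rewrite is_max_next root_fixed ?arc_map_next.
by move/forallP/(_ j)/implyP; apply; rewrite (pblock_same (mem_root i)).
Qed.

Lemma eq_root i j : (root block_next i == root block_next j) = (j \in pblock P i).
Proof.
apply/eqP/idP => [eqr|jP].
  by rewrite -(pblock_same (mem_root i)) eqr (pblock_same (mem_root j)) pblock_refl.
have jiP := pblock_same jP; apply/val_inj/eqP; rewrite eqn_leq !root_max //.
  by rewrite -jiP mem_root.
by rewrite jiP mem_root.
Qed.

Lemma diagram_partition_next : diagram_partition block_next = P.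
Proof.
rewrite -[RHS](equivalence_partition_pblock partP).
apply: eq_imset => i; apply/setP => j; rewrite !inE; exact: eq_root.
Qed.

End Next.

Lemma next_diagram_partition n (F : {ffun 'I_n -> 'I_n}) :
  arc_map F -> block_next (diagram_partition F) = F.
Proof.
move=> arcF; have [leF injF] := arc_mapP _ arcF; apply/ffunP => i.
have partP := diagram_partitionP F.
have edge_arc : (i < F i)%N -> edge (diagram_partition F) i (F i).
  move=> lt_i; apply/edgeP; rewrite pblock_diagram root_arc //; split=> // k.
  rewrite pblock_diagram => /eqP eqr lt_ik.
  have /iter_findex := eq_root_fconnect arcF eqr (ltnW lt_ik).
  case: findex => [|a]; first by move=> /= ik; rewrite ik ltnn in lt_ik.
  by rewrite iterSr => <-; apply: iter_arc_ge.
have := nextP (diagram_partition F) i; case: ifP => [maxi ->|_ en].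
  apply/eqP; rewrite eq_sym -(inj_eq val_inj) eqn_leq leF leqNgt andbT.
  by apply: contraTN maxi => /edge_arc eF; apply/is_maxPn => //; exists (F i).
case/edgeP: (en) => lt_in; rewrite pblock_diagram => /eqP eqr _.
have [lt_iF|] := ltnP i (F i); first exact: edge_fun en (edge_arc lt_iF).
move=> le_Fi; have Fi : F i = i by apply/val_inj/eqP; rewrite eqn_leq leF le_Fi.
have /iter_findex := eq_root_fconnect arcF eqr (ltnW lt_in).
by rewrite iter_fixed // => in_; rewrite -in_ ltnn in lt_in.
Qed.

(** * Statistics of a partition, read off its arc diagram *)

(** Every set of tuples that is counted below is determined by two of its
    entries, the middle point j and a right end l pending at j. *)
Lemma card_fibers (U : finType) n (A : {set U}) (f : U -> 'I_n * 'I_n)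
    (T : pred 'I_n) (B : 'I_n -> {set 'I_n}) :
  {in A &, injective f} ->
  (forall j l, reflect (exists2 u, u \in A & f u = (j, l)) (T j && (l \in B j))) ->
  #|A| = (\sum_(j | T j) #|B j|)%N.
Proof.
move=> injf fA; rewrite -(card_in_imset injf).
under eq_bigr => j _ do rewrite -sum1_card.
rewrite pair_big_dep /= -sum1_card; apply: eq_bigl => -[j l] /=.
by apply/imsetP/fA => -[u uA fu]; exists u.
Qed.

Section Statistics.
Variables (n : nat) (P : {set {set 'I_n}}).
Hypothesis partP : partition P [set: 'I_n].
Implicit Types (i j k l : 'I_n).
Let F := block_next P.
Let arcF : arc_map F := arc_map_next partP.

Lemma hitP i : reflect (exists j, edge P j i) (i \in pending F i).
Proof.
apply: (iffP (pendingP F i i)) => [[j [lt_ji _ Fj]]|[j]].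
  by exists j; rewrite edge_next // lt_ji -/F Fj eqxx.
by rewrite edge_next // => /andP[lt_ji /eqP Fj]; exists j.
Qed.

Lemma is_min_next i : is_min P i = (i \notin pending F i).
Proof. by apply/negb_inj; rewrite negbK; apply/(is_minPn partP)/hitP. Qed.

Lemma card_block_eq1 i : singleton P i = is_min P i && is_max P i.
Proof.
rewrite /singleton; have iP := pblock_refl partP i.
apply/cards1P/andP => [[a Pa]|[/forallP mini /forallP maxi]].
  move: iP; rewrite /is_min /is_max Pa => /set1P->.
  by split; apply/forallP => j; apply/implyP => /set1P->.
exists i; apply/setP => j; rewrite in_set1; apply/idP/eqP => [jP|->//].
by apply/val_inj/eqP; rewrite eqn_leq (implyP (mini j)) ?(implyP (maxi j)).
Qed.

Lemma singletonE i : singleton P i = (F i == i) && (i \notin pending F i).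
Proof. by rewrite card_block_eq1 is_min_next is_max_next // andbC. Qed.

Lemma card_block_ge2 i : (2 <= #|pblock P i|)%N = ~~ singleton P i.
Proof.
rewrite ltn_neqAle eq_sym card_gt0 /singleton.
by have /set0Pn-> : exists j, j \in pblock P i; [exists i; apply: pblock_refl | rewrite andbT].
Qed.

Lemma openerE i : opener P i = (F i != i) && (i \notin pending F i).
Proof.
rewrite /opener card_block_ge2 singletonE is_min_next.
by case: (F i == i); case: (i \in _).
Qed.

Lemma arc_lt i : F i != i -> (i < F i)%N.
Proof.
by case/arc_mapP: arcF => leF _ ni; rewrite ltn_neqAle leF andbT (inj_eq val_inj) eq_sym.
Qed.

Lemma insiderE i : insider P i = (F i != i) && (i \in pending F i).
Proof.
rewrite /insider /opener /closer is_min_next is_max_next // negb_and negb_and.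
apply/and3P/andP => [[gt2]|[/arc_lt lt_iF iF]].
  by rewrite (ltnW gt2) /= negbK => ? ?.
rewrite iF !orbT -(inj_eq val_inj) -/F neq_ltn lt_iF !orbT; split=> //.
case/hitP: iF => j eji.
have /edgeP[lt_ji iPj _] := eji; have iP := pblock_refl partP.
have /edgeP[_ FP _] : edge P i (F i) by rewrite edge_next // lt_iF eqxx.
apply/card_gt2P; exists j, i, (F i); split; split=> //.
- by rewrite (pblock_same partP iPj) pblock_refl.
- by rewrite -(inj_eq val_inj) neq_ltn lt_ji.
- by rewrite -(inj_eq val_inj) neq_ltn lt_iF.
by rewrite -(inj_eq val_inj) neq_ltn (ltn_trans lt_ji) ?orbT.
Qed.

Lemma sigma'E i : sigma' P i = if F i == i then 0%N else (F i).+1.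
Proof.
rewrite /sigma'; case: pickP => [j|no].
  rewrite edge_next // => /andP[lt_ij /eqP Fj]; rewrite /F Fj.
  
by case: eqP => // ji; rewrite ji ltnn in lt_ij.
case: eqP => // /eqP/arc_lt lt_i; have := no (F i).
by rewrite edge_next // lt_i eqxx.
Qed.

(** An earlier element j violates the record condition at i exactly when its
    arc ends beyond F i, and then this arc is pending at i.  Ties do not occur,
    since two arcs never share their right end. *)
Lemma exclusive_recordE i :
  exclusive_record P i =
  (F i != i) && (#|[set l : 'I_n in pending F i | (F i < l)%N]| == 0%N).
Proof.
have [_ injF] := arc_mapP _ arcF.
rewrite /exclusive_record sigma'E; case: (eqVneq (F i) i) => //= ni.
rewrite cards_eq0; apply/forallP/eqP => [rec|none j].
  apply/setP => l; rewrite in_set0 in_set; apply/andP => -[/pendingP[j [lt_ji le_il Fj]]].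
  have := implyP (rec j) lt_ji; rewrite sigma'E Fj; case: eqP => [lj|_].
    by rewrite lj leqNgt lt_ji in le_il.
  by rewrite ltnS ltnNge => /negP nlt /ltnW.
apply/implyP => lt_ji; rewrite sigma'E; case: eqVneq => // nj; rewrite ltnS ltnNge.
apply/negP => le_ij; have := in_set0 (F j); rewrite -none in_set => /negP; apply.
have lt_i := arc_lt ni; have lt_j := arc_lt nj.
apply/andP; split.
  by apply/pendingP; exists j; split=> //; apply: leq_trans le_ij; apply: ltnW.
rewrite ltn_neqAle le_ij andbT (inj_eq val_inj); apply/eqP => Fij.
by rewrite (injF i j) ?ltnn in lt_ji.
Qed.

(** Each block of size at least 2 has one opener, its minimum. *)
Lemma mge2E : mge2 P = #|[set i | opener P i]|.
Proof.
have injb : {in [set i | opener P i] &, injective (pblock P)}.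
  move=> i j; rewrite !inE => /andP[_ /forallP mini] /andP[_ /forallP minj] eqb.
  apply/val_inj/eqP; rewrite eqn_leq (implyP (mini j)) ?(implyP (minj i)) //.
    by rewrite -eqb pblock_refl.
  by rewrite eqb pblock_refl.
rewrite -(card_in_imset injb) /mge2; apply: eq_card => B; rewrite inE.
apply/andP/imsetP => [[BP cB]|[i]]; last first.
  by rewrite inE => /andP[ci _] ->; rewrite ci pblock_mem // (cover_partition partP).
have [i iB] : exists i, i \in B by apply/set0Pn; rewrite -card_gt0 ltnW.
have tiP : trivIset P by case/and3P: partP.
have [m mB minm] := @arg_minnP _ i (mem B) (fun j : 'I_n => j : nat) iB.
have bm : pblock P m = B := def_pblock tiP BP mB.
exists m; rewrite // inE /opener bm cB; apply/forallP => j; apply/implyP.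
by rewrite bm; apply: minm.
Qed.

(** In a crossing with second entry j, the last entry is F j and the first is the
    start of the pending arc that ends at the third. *)
Lemma crossing_count (T : pred 'I_n) :
  num_quad (fun i j k l => crossing P i j k l && T j) =
  (\sum_(j | T j) #|[set l in pending F j | (j < l < F j)%N]|)%N.
Proof.
have [_ injF] := arc_mapP _ arcF.
apply: (card_fibers (f := fun u => (u.1.1.2, u.1.2))).
  move=> [[[i j] k] l] [[[i' j'] k'] l']; rewrite !inE /crossing !edge_next //= -/F.
  move=> /andP[/and5P[_ _ _ /andP[lt_ik /eqP Fi] /andP[_ /eqP Fj]] _].
  move=> /andP[/and5P[_ _ _ /andP[lt_ik' /eqP Fi'] /andP[_ /eqP Fj']] _] [jj kk].
  by rewrite -Fj -Fj' jj kk (injF i i') ?Fi ?Fi'.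
move=> j k; rewrite in_set; apply: (iffP andP) => [[Tj]|[[[[i j'] k'] l]]].
  case/andP => /pendingP[i [lt_ij le_jk Fi]] /andP[lt_jk lt_kF].
  exists (i, j, k, F j) => //; rewrite inE /crossing !edge_next // -/F Fi Tj
    lt_ij lt_jk lt_kF.
  by rewrite !eqxx (ltn_trans lt_ij) //= (ltn_trans lt_jk).
rewrite in_set /crossing !edge_next //= -/F.
move=> /andP[/and5P[lt_ij lt_jk lt_kl /andP[_ /eqP Fi] /andP[_ /eqP Fj]] Tj] [<- <-].
split=> //; rewrite lt_jk Fj lt_kl !andbT; apply/pendingP; exists i; split=> //.
exact: ltnW.
Qed.

(** The condition on T makes j the start of an arc, which is the inner arc of the
    nesting; without an arc at j, pending ends would be counted with no
    nesting to match them. *)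
Lemma nesting_count (T : pred 'I_n) : (forall j, T j -> F j != j) ->
  num_quad (fun i j k l => nesting P i j k l && T j) =
  (\sum_(j | T j) #|[set l : 'I_n in pending F j | (F j < l)%N]|)%N.
Proof.
have [_ injF] := arc_mapP _ arcF; move=> TF.
apply: (card_fibers (f := fun u => (u.1.1.2, u.2))).
  move=> [[[i j] k] l] [[[i' j'] k'] l']; rewrite !inE /nesting !edge_next //= -/F.
  move=> /andP[/and5P[_ _ _ /andP[lt_il /eqP Fi] /andP[_ /eqP Fj]] _].
  move=> /andP[/and5P[_ _ _ /andP[lt_il' /eqP Fi'] /andP[_ /eqP Fj']] _] [jj ll].
  by rewrite -Fj -Fj' jj ll (injF i i') ?Fi ?Fi'.
move=> j l; rewrite in_set; apply: (iffP andP) => [[Tj]|[[[[i j'] k'] l']]].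
  case/andP => /pendingP[i [lt_ij le_jl Fi]] lt_Fl; have /arc_lt lt_j := TF _ Tj.
  exists (i, j, F j, l) => //; rewrite inE /nesting !edge_next // -/F Fi Tj
    lt_ij lt_j lt_Fl.
  by rewrite !eqxx (ltn_trans lt_ij) //= (ltn_trans lt_j).
rewrite in_set /nesting !edge_next //= -/F.
move=> /andP[/and5P[lt_ij lt_jk lt_kl /andP[_ /eqP Fi] /andP[_ /eqP Fj]] Tj] [<- <-].
split=> //; rewrite Fj lt_kl !andbT; apply/pendingP; exists i; split=> //.
by rewrite ltnW // (ltn_trans lt_jk).
Qed.

Lemma psne_count :
  psne P = (\sum_(j | singleton P j) #|[set l : 'I_n in pending F j | (j < l)%N]|)%N.
Proof.
have [_ injF] := arc_mapP _ arcF.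
apply: (card_fibers (f := fun u => (u.1.2, u.2))).
  move=> [[i j] l] [[i' j'] l']; rewrite !inE !edge_next //= -/F.
  move=> /and4P[_ _ _ /andP[lt_il /eqP Fi]] /and4P[_ _ _ /andP[lt_il' /eqP Fi']] [jj ll].
  by rewrite jj ll (injF i i') ?Fi ?Fi'.
move=> j l; rewrite in_set; apply: (iffP andP) => [[Tj]|[[[i j'] l']]].
  case/andP => /pendingP[i [lt_ij le_jl Fi]] lt_jl.
  by exists (i, j, l) => //; rewrite inE !edge_next // -/F Fi Tj
    lt_ij lt_jl eqxx (ltn_trans lt_ij).
rewrite in_set !edge_next //= -/F => /and4P[lt_ij lt_jl Tj /andP[_ /eqP Fi]] [<- <-].
by split=> //; rewrite lt_jl !andbT; apply/pendingP; exists i; split=> //; apply: ltnW.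
Qed.

Lemma expr_card (R : comNzRingType) (x : R) (c : pred 'I_n) :
  x ^+ #|[set i | c i]| = \prod_i x ^+ c i.
Proof.
rewrite -sum1_card prodrXr; congr (_ ^+ _); rewrite big_mkcond; apply: eq_bigr => i _.
by rewrite inE; case: (c i).
Qed.

Lemma expr_sum_cond (R : comNzRingType) (x : R) (c : pred 'I_n) (e : 'I_n -> nat) :
  x ^+ (\sum_(i | c i) e i)%N = \prod_i (if c i then x ^+ e i else 1).
Proof. by rewrite -prodrXr big_mkcond. Qed.

(** Each statistic is a sum over the middle point j, so its power is a product
    over j; the factor at each j is then compared for the four types. *)
Lemma partition_weight (R : comNzRingType) (x1 x2 y1 y2 v1 v2 p1 p2 q1 q2 r : R) :
  x1 ^+ m1 P * x2 ^+ mge2 P * y1 ^+ erecin P * y2 ^+ erecop P *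
  v1 ^+ nerecin P * v2 ^+ nerecop P * p1 ^+ crin P * p2 ^+ crop P *
  q1 ^+ nein P * q2 ^+ neop P * r ^+ psne P =
  prefix_weight x1 x2 y1 y2 v1 v2 p1 p2 q1 q2 r n F.
Proof.
rewrite mge2E /m1 /erecin /erecop /nerecin /nerecop /crin /crop /nein /neop.
rewrite !crossing_count !nesting_count; first last.
- by move=> i; rewrite insiderE => /andP[].
- by move=> i; rewrite openerE => /andP[].
rewrite psne_count !expr_card !expr_sum_cond -!big_split /= /prefix_weight.
apply: eq_big => [i|i _]; first by rewrite ltn_ord.
rewrite singletonE openerE insiderE exclusive_recordE /step_weight /arc_weight.
case: (F i == i); case: (i \in pending F i); case: (_ == 0)%N;
  rewrite /= ?expr0 ?expr1 ?mulr1 ?mul1r //.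
1,2: by rewrite -mulrA mulrC.
all: by rewrite -!mulrA; congr (x2 * _); rewrite mulrC -mulrA.
Qed.

End Statistics.

(** * The continued fraction *)

Theorem theorem3p3 (R : comNzRingType)
    (x1 x2 y1 y2 v1 v2 p1 p2 q1 q2 r : R) (gam bet : nat -> R)
    (gam0 : gam 0%N = x1)
    (gamE : forall n : nat, (1 <= n)%N ->
       gam n = r ^+ n * x1 + p1 ^+ (n - 1) * y1
               + q1 * pqnum p1 q1 (n - 1) * v1)
    (betE : forall n : nat, (1 <= n)%N ->
       bet n = x2 * (p2 ^+ (n - 1) * y2 + q2 * pqnum p2 q2 (n - 1) * v2)) :
  jfraction gam bet (Bpoly x1 x2 y1 y2 v1 v2 p1 p2 q1 q2 r).
Proof.
apply: motzkin_jfraction => n; rewrite -(cards0 'I_n).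
rewrite -(prefix_sumE gam0 gamE betE (leqnn n)); last by move=> l; rewrite inE.
rewrite /Bpoly /prefix_sum (reindex_onto (@diagram_partition n) (@block_next n)); last first.
  by move=> P; apply: diagram_partition_next.
apply: eq_big => [F|F /andP[partF /eqP nextF]]; last by rewrite partition_weight // nextF.
rewrite diagram_partitionP /=; apply/eqP/and3P => [<-|[arcF _ _]].
  have arcF := arc_map_next (diagram_partitionP F); split=> //.
    by apply/supportedP => i; rewrite leqNgt ltn_ord.
  apply/eqP/setP => l; rewrite in_set0; apply/pendingP => -[i [_]].
  by rewrite leqNgt ltn_ord.
exact: next_diagram_partition.
Qed.
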